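(* There exist integers $\mathfrak{n}>\mathfrak{m}\ge2$ and a topologically transitive subshift $\Sigma\subseteq\Delta_{\mathfrak{m},\mathfrak{n}}^{\mathbb{N}}$ with $0<h(\pi\Sigma)<h(\Sigma)$ such that the box dimension of $\Pi(\Sigma)$ exists and $$\dim_{\mathrm{B}}\Pi(\Sigma)=\max\left\{\frac{h(\Sigma)}{\log\mathfrak{n}},\frac{h(\pi\Sigma)}{\log\mathfrak{m}}\right\}.$$
   Context: Let $\mathfrak{n}>\mathfrak{m}\ge2$ be integers and $\Delta_{\mathfrak{m},\mathfrak{n}}=\{(a,b): 1\le a\le\mathfrak{m},\ 1\le b\le\mathfrak{n},\ a,b\in\mathbb{N}\}$. For $(a,b)\in\Delta_{\mathfrak{m},\mathfrak{n}}$ let $S_{(a,b)}:[0,1]^2\to[0,1]^2$, $S_{(a,b)}(x,y)=\left(\frac{x+a-1}{\mathfrak{m}},\frac{y+b-1}{\mathfrak{n}}\right)$. The coding map $\Pi:\Delta_{\mathfrak{m},\mathfrak{n}}^{\mathbb{N}}\to[0,1]^2$ is $\Pi((a_1,b_1)(a_2,b_2)\ldots)=\lim_{n\to\infty}S_{(a_1,b_1)}\circ\cdots\circ S_{(a_n,b_n)}(0)$. A subshift is a compact set $\Sigma$ of sequences over a finite alphabet (here a digit set $\mathcal{I}\subseteq\Delta_{\mathfrak{m},\mathfrak{n}}$) with $\sigma(\Sigma)\subseteq\Sigma$, where $\sigma$ is the left shift. $\Sigma^*$ denotes the language of $\Sigma$ (finite words appearing in sequences of $\Sigma$), $\Sigma_n$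 the words of length $n$ in $\Sigma^*$, and the topological entropy is $h(\Sigma)=\lim_{n\to\infty}\frac1n\log\#\Sigma_n$. $\Sigma$ is topologically transitive if for all $\mathtt{i},\mathtt{j}\in\Sigma^*$ there exists $\mathtt{k}\in\Sigma^*$ such that $\mathtt{i}\mathtt{k}\mathtt{j}\in\Sigma^*$. The projection $\pi$ is $\pi((a_1,b_1)(a_2,b_2)\ldots)=a_1a_2\ldots$; $\pi\Sigma$ is again a subshift. For bounded $E$, $N_\delta(E)$ is the smallest number of sets of diameter $\delta$ needed to cover $E$; $\underline{\dim}_{\mathrm{B}}E$ and $\overline{\dim}_{\mathrm{B}}E$ are the lower and upper limits as $\delta\to0$ of $\log N_\delta(E)/(-\log\delta)$, and $\dim_{\mathrm{B}}E$ is their common value when they coincide. *)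

(* Defs.v *)
From HB Require Import structures.
From mathcomp Require Import all_boot all_order all_algebra.
From mathcomp Require Import finmap.
From mathcomp Require Import all_classical all_reals all_analysis.
Import Order.TTheory GRing.Theory Num.Theory.
Import numFieldNormedType.Exports.

Set Implicit Arguments.
Unset Strict Implicit.
Unset Printing Implicit Defensive.

Local Open Scope classical_set_scope.
Local Open Scope ring_scope.

(* One-sided sequences over T are functions nat -> T; the first symbol has
   index 0. *)

Definition left_shift (T : Type) (x : nat -> T) : nat -> T := fun i => x i.+1.

(* The alphabet A sits inside an ambient type T whose topology is discrete in
   all uses below (nat and nat * nat), so that {ptws nat -> T} induces on the
   sequences over A the product of the discrete topologies. *)
Definition is_subshift (T : topologicalType) (A : set T)
    (Sigma : set (nat -> T)) : Prop :=
  [/\ finite_set A,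
      (forall x, Sigma x -> forall i, A (x i)),
      compact (Sigma : set {ptws nat -> T}) &
      @left_shift T @` Sigma `<=` Sigma].

Definition language (T : Type) (Sigma : set (nat -> T)) : set (seq T) :=
  [set w | exists x k,
     Sigma x /\ w = mkseq (fun i => x (k + i)%N) (size w)].

Definition words (T : Type) (Sigma : set (nat -> T)) (n : nat) : set (seq T) :=
  [set w | language Sigma w /\ size w = n].

Definition topologically_transitive (T : Type) (Sigma : set (nat -> T)) : Prop :=
  forall i j, language Sigma i -> language Sigma j ->
    exists2 k, language Sigma k & language Sigma (i ++ k ++ j).

(* The cardinal is the intended one because words Sigma n is finite for a
   finite alphabet, and the limit exists for every subshift by Fekete's lemma. *)
Definition entropy (R : realType) (T : choiceType) (Sigma : set (nat -> T)) : R :=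
  lim ((fun n : nat =>
          (n%:R)^-1 * ln (#|` fset_set (words Sigma n)|%:R : R)) @ \oo).

Definition Delta (m n : nat) : set (nat * nat) :=
  [set d | (1 <= d.1 <= m)%N && (1 <= d.2 <= n)%N].

Definition proj_seq (x : nat -> nat * nat) : nat -> nat := fun i => (x i).1.

Definition affine_map (R : realType) (m n : nat) (d : nat * nat) (p : R * R) :
    R * R :=
  ((p.1 + d.1%:R - 1) / m%:R, (p.2 + d.2%:R - 1) / n%:R).

(* foldr yields S_(d_1) o ... o S_(d_k) applied to the origin.  The body is the
   unfolding of lim, which R * R does not support for want of a
   pointedNbhs instance. *)
Definition coding_map (R : realType) (m n : nat) (x : nat -> nat * nat) : R * R :=
  get [set p : R * R |
    (fun k : nat => foldr (@affine_map R m n) (0, 0) (mkseq x k)) @ \oo --> p].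

Definition euclid_dist (R : realType) (p q : R * R) : R :=
  Num.sqrt ((p.1 - q.1) ^+ 2 + (p.2 - q.2) ^+ 2).

Definition diameter (R : realType) (U : set (R * R)) : \bar R :=
  ereal_sup [set (euclid_dist pq.1 pq.2)%:E | pq in U `*` U].

Definition coverable (R : realType) (E : set (R * R)) (delta : R) (k : nat) :
    Prop :=
  exists U : 'I_k -> set (R * R),
    (forall i, diameter (U i) = delta%:E) /\ E `<=` \bigcup_i U i.

(* The least k exists for bounded E and delta > 0; otherwise the value 0 is a
   default. *)
Definition covering_number (R : realType) (E : set (R * R)) (delta : R) : nat :=
  xget 0%N [set k | coverable E delta k /\
                    forall j, coverable E delta j -> (k <= j)%N].

Definition box_ratio (R : realType) (E : set (R * R)) (delta : R) : \bar R :=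
  (ln (covering_number E delta)%:R / - ln delta)%:E.

Definition lower_box_dim (R : realType) (E : set (R * R)) : \bar R :=
  limf_einf (box_ratio E) 0^'+.

Definition upper_box_dim (R : realType) (E : set (R * R)) : \bar R :=
  limf_esup (box_ratio E) 0^'+.

Definition has_box_dim (R : realType) (E : set (R * R)) (s : R) : Prop :=
  lower_box_dim E = s%:E /\ upper_box_dim E = s%:E.

(* Main.v *)
Require Import Defs.
From mathcomp Require Import all_boot all_order all_algebra.
From mathcomp Require Import finmap zify ring lra.
From mathcomp Require Import all_classical all_reals all_analysis.
Import Order.TTheory GRing.Theory Num.Theory.
Import numFieldNormedType.Exports.

(** The example has m = 2 and n = 4.  Its subshift contains every sequence over
    the horizontal digits (a, 1) and every sequence over the vertical digits
    (1, b); all its other sequences together have only linearly many words of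
    each length.  The entropy of Sigma is then carried by the vertical
    sequences and equals ln 4, whereas the entropy of its projection is carried
    by the horizontal ones and equals ln 2.  Since vertical sequences have a
    trivial projection, no orbit contributes to both entropies; this is why
    the dimension is a maximum and not a weighted sum.  Geometrically, the
    image contains the left side of the unit square and is contained, at scale
    4^-k, in the union of the left side, the bottom side and O(k) further
    squares.  Its box dimension is 1 = ln 4 / ln 4 = ln 2 / ln 2.

    Transitivity forces sequences that mix the two kinds of digits, and the
    difficulty is to keep them few.  Sigma is the orbit closure of the limit of
    words with stage (t + 1) = stage t, blanks, w, blanks, stage t, where w
    runs through all words of the two kinds, the digit (1, 1) serves as a
    blank, and each run of blanks is longer than stage t and w together.
    Repeating stage t makes the limit recurrent, hence its orbit closure
    transitive.  For a window of length k, choose the least t whose runs of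
    blanks reach length k.  Such a window cannot see both ends of a later run,
    so it shows, among blanks, a piece of a single word w or of a single copy
    of stage t; and stage t has length at most 4 k, because the runs of blanks
    inside it are shorter than k.  Thus all but 5 k + 1 windows are horizontal
    or vertical ([windows_of_limit_point]).

    This one count gives both the entropy ([card_words_sparse]) and the upper
    bound for coverings ([coverable_sparse]): a square of side 4^-k is fixed by
    2 k first coordinates and k second ones, so horizontal and vertical
    sequences meet 4^k squares each.  The vertical sequences alone give 4^k
    points at mutual distance at least 4^-k, the matching lower bound
    ([coverable_sparse_ge]).  The factor linear in k disappears in the limit
    because ln (k + 1) / k tends to 0. *)

(** * Words over a finite alphabet *)

Fixpoint words_over {T : Type} (A : seq T) (k : nat) : seq (seq T) :=
  if k is k'.+1 then [seq a :: w | a <- A, w <- words_over A k'] else [:: [::]].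

Lemma size_words_over {T : Type} (A : seq T) (k : nat) :
  size (words_over A k) = size A ^ k.
Proof. by elim: k => //= k IH; rewrite size_allpairs IH expnS. Qed.

Lemma mem_words_over {T : eqType} (A : seq T) (k : nat) (w : seq T) :
  (w \in words_over A k) = (size w == k) && all [in A] w.
Proof.
elim: k w => [|k IH] [|b w] //=.
  by apply/allpairsP => -[[a v] /= [_ _]].
rewrite eqSS andbCA -IH; apply/allpairsP/andP => [[[a v] /= [aA vk [-> ->]]]|[bA wk]].
  by [].
by exists (b, w).
Qed.

Lemma uniq_words_over {T : eqType} (A : seq T) (k : nat) :
  uniq A -> uniq (words_over A k).
Proof.
move=> uA; elim: k => //= k IH; apply: allpairs_uniq => //.
by move=> [a v] [b w] _ _ /= [-> ->].
Qed.

(** * A recurrent point with few words *)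

(** The one digit that is both horizontal and vertical.  As it labels the
    contraction fixing the origin, it is also harmless to append. *)
Definition blank : nat * nat := (1, 1).

Definition hletters : seq (nat * nat) := [seq (a, 1) | a <- iota 1 2].
Definition vletters : seq (nat * nat) := [seq (1, b) | b <- iota 1 4].

(** Such words move the origin along one side of the unit square: the bottom side
    for horizontal letters, the left side for vertical ones. *)
Definition straight : pred (seq (nat * nat)) :=
  [pred w | all [in hletters] w || all [in vletters] w].

(** An enumeration of the straight words, through the countability of all words;
    the indices that encode no straight word give the empty word. *)
Definition nth_straight (t : nat) : seq (nat * nat) :=
  if choice.unpickle t is Some w then if straight w then w else [::] else [::].

Lemma nth_straight_straight (t : nat) : straight (nth_straight t).
Proof. by rewrite /nth_straight; case: choice.unpickle => //= w; case: ifP. Qed.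

Lemma nth_straight_pickle (w : seq (nat * nat)) :
  straight w -> nth_straight (choice.pickle w) = w.
Proof. by move=> pw; rewrite /nth_straight choice.pickleK pw. Qed.

(** The gap has to exceed everything next to it: this is what makes the length
    of the next stage linear in the gap (see [size_stage_gap]), and the successor
    makes the stages grow even where the inserted word is empty. *)
Definition gap_after (z w : seq (nat * nat)) : nat := (size z + size w).+1.

Fixpoint stage (t : nat) : seq (nat * nat) :=
  if t is s.+1 then
    let z := stage s in let w := nth_straight s in
    let g := nseq (gap_after z w) blank in z ++ g ++ w ++ g ++ z
  else [::].

Definition gap (t : nat) : nat := gap_after (stage t) (nth_straight t).

Lemma stageS (t : nat) :
  stage t.+1 = stage t ++ nseq (gap t) blank ++ nth_straight t ++
               nseq (gap t) blank ++ stage t.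
Proof. by []. Qed.

Lemma size_stageS (t : nat) :
  size (stage t.+1) = size (stage t) + gap t + size (nth_straight t) + gap t
                      + size (stage t).
Proof. by rewrite stageS !size_cat !size_nseq !addnA. Qed.

Lemma size_stage_ge (t : nat) : t <= size (stage t).
Proof.
elim: t => // t IH; rewrite size_stageS.
have : 0 < gap t by []. lia.
Qed.

Lemma gap_mono (t : nat) : gap t < gap t.+1.
Proof. by rewrite [gap t.+1]/gap /gap_after size_stageS /gap /gap_after; lia. Qed.

Lemma leq_gap (t s : nat) : t <= s -> gap t <= gap s.
Proof.
by apply: (@homo_leq _ gap leq) => [//| ? ? ?|n]; [exact: leq_trans|exact/ltnW/gap_mono].
Qed.

Lemma gap_ge (t : nat) : t < gap t.
Proof. by rewrite /gap /gap_after ltnS; have := size_stage_ge t; lia. Qed.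

(** Every stage is a prefix of the next one, and [stage i.+1] has more than [i]
    letters, so this is the common extension of all stages. *)
Definition limit_point (i : nat) : nat * nat := nth blank (stage i.+1) i.

Lemma leq_size_stage (t s : nat) : t <= s -> size (stage t) <= size (stage s).
Proof.
apply: (@homo_leq _ (size \o stage) leq) => [//| ? ? ?|n] /=; first exact: leq_trans.
by rewrite size_stageS; lia.
Qed.

Lemma nth_stage (t s i : nat) : t <= s -> i < size (stage t) ->
  nth blank (stage s) i = nth blank (stage t) i.
Proof.
move=> + it; elim: s => [|s IH]; first by rewrite leqn0 => /eqP ->.
rewrite leq_eqVlt => /predU1P[-> //|]; rewrite ltnS => ts.
by rewrite stageS nth_cat -(IH ts) (leq_trans it (leq_size_stage _ _ ts)).
Qed.

Lemma limit_pointE (t i : nat) : i < size (stage t) ->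
  limit_point i = nth blank (stage t) i.
Proof.
move=> it; have ii := size_stage_ge i.+1.
by case: (leqP t i.+1) => [le|/ltnW le]; rewrite /limit_point; [|symmetry]; apply: nth_stage.
Qed.

(** A window into the two-sided infinite word made of [z] and blanks all around:
    the [p] blanks are written out on the left, and the default value of [nth]
    supplies those on the right. *)
Definition occurs (L : nat) (u : nat -> nat * nat) (z : seq (nat * nat)) : Prop :=
  exists p j, forall i, i < L -> u i = nth blank (nseq p blank ++ z) (j + i).

(** A window no longer than a run of blanks cannot see past both of its ends. *)
Lemma occurs_cat (L g : nat) (u : nat -> nat * nat) (y z : seq (nat * nat)) :
  L <= g -> occurs L u (y ++ nseq g blank ++ z) -> occurs L u y \/ occurs L u z.
Proof.
move=> Lg [p [j uE]].
case: (leqP (j + L) (p + size y + g)) => jL.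
  left; exists p, j => i iL; rewrite uE // !nth_cat !size_nseq.
  case: ifP => // _; case: ifP => // iy.
  rewrite ifT ?nth_nseq; last by lia.
  by rewrite nth_default ?if_same //; lia.
right; exists g, (j - p - size y) => i iL.
rewrite uE // !nth_cat !size_nseq ifF; last by lia.
rewrite ifF; last by lia.
have -> : j + i - p - size y = j - p - size y + i by lia.
by [].
Qed.

(** Later stages are built from copies of [stage t] and straight words by
    separations of length at least [gap t], so short windows see no difference. *)
Lemma occurs_stage (L t s : nat) (u : nat -> nat * nat) :
  L <= gap t -> t <= s -> occurs L u (stage s) ->
  occurs L u (stage t) \/ exists2 w, straight w & occurs L u w.
Proof.
move=> Lt; elim: s => [|s IH]; first by rewrite leqn0 => /eqP ->; left.
rewrite leq_eqVlt => /predU1P[->|]; first by left.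
rewrite ltnS => ts; rewrite stageS.
have Ls : L <= gap s by apply: leq_trans (leq_gap t s ts).
case/(occurs_cat L _ u _ _ Ls) => [/(IH ts) //|].
case/(occurs_cat L _ u _ _ Ls) => [uw|/(IH ts) //].
by right; exists (nth_straight s) => //; exact: nth_straight_straight.
Qed.

Lemma occurs_all (L : nat) (u : nat -> nat * nat) (w A : seq (nat * nat)) :
  blank \in A -> all [in A] w -> occurs L u w -> mkseq u L \in words_over A L.
Proof.
move=> bA wA [p [j uE]]; rewrite mem_words_over size_mkseq eqxx /=.
apply/allP => a /mapP[i]; rewrite mem_iota add0n => iL ->; rewrite uE //.
have [ji|ji] := ltnP (j + i) (size (nseq p blank ++ w)); last by rewrite nth_default.
have := mem_nth blank ji; rewrite mem_cat => /orP[/nseqP[-> _] //|].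
by move/(allP wA).
Qed.

Definition blank_windows (L : nat) (z : seq (nat * nat)) : seq (seq (nat * nat)) :=
  [seq mkseq (fun i => nth blank (nseq L blank ++ z) (j + i)) L
  | j <- iota 0 (L + size z).+1].

(** A window that starts more than [L] letters before [z], or after its end, is
    blank, and the two extreme positions already show that; hence the linear
    number of windows. *)
Lemma occurs_blank_windows (L : nat) (u : nat -> nat * nat) (z : seq (nat * nat)) :
  occurs L u z -> mkseq u L \in blank_windows L z.
Proof.
move=> [p [j uE]]; apply/mapP.
(* The truncation and the minimum send windows that are entirely blank to the
   extreme positions. *)
exists (minn (j + L - p) (L + size z)); first by rewrite mem_iota; lia.
apply/eq_in_map => i; rewrite mem_iota add0n => iL /=; rewrite uE // !nth_cat !size_nseq.
rewrite !nth_nseq !if_same.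
case: (leqP (j + L - p) (L + size z)) => jL.
- case: (ltnP (j + i) p) => jp; first by rewrite ifT //; lia.
  by case: ifP => jp2; [lia | congr nth; lia].
- rewrite ifF; last by lia.
  by rewrite ifF ?nth_default //; lia.
Qed.

(** For the least [t] whose gap reaches [L], the two outermost gaps in [stage t] are
    shorter than [L], and each of them exceeds the words that it separates. *)
Lemma size_stage_gap (L : nat) :
  exists t, L <= gap t /\ size (stage t) <= 4 * L.
Proof.
have /ex_minnP[t Lt mint] : exists t, L <= gap t by exists L; exact/ltnW/gap_ge.
exists t; split => //; case: t Lt mint => // t Lt mint; rewrite size_stageS.
have : gap t < L by rewrite ltnNge; apply/negP => /mint; rewrite ltnn.
by rewrite /gap /gap_after; lia.
Qed.

(** The count on which both the entropy and the covering numbers rest: apart from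
    the two full families of straight words, only linearly many words occur. *)
Lemma windows_of_limit_point (L : nat) :
  exists E : seq (seq (nat * nat)), size E <= (5 * L).+1 /\
    forall j, mkseq (fun i => limit_point (j + i)) L
      \in words_over hletters L ++ words_over vletters L ++ E.
Proof.
have [t [Lt szt]] := size_stage_gap L.
exists (blank_windows L (stage t)); rewrite size_map size_iota; split; first by lia.
move=> j; set u := fun i => _.
have : occurs L u (stage (maxn t (j + L))).
  exists 0, j => i iL; rewrite /u /=; apply: limit_pointE.
  by have := size_stage_ge (maxn t (j + L)); lia.
case/(occurs_stage L t _ u Lt (leq_maxl _ _)) => [/occurs_blank_windows uE|[w /orP[] pw uw]].
- by rewrite !mem_cat uE !orbT.
- by rewrite mem_cat (occurs_all _ _ _ _ _ pw uw).
- by rewrite !mem_cat (occurs_all _ _ _ _ _ pw uw) ?orbT.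
Qed.

Lemma limit_point_straight (w : seq (nat * nat)) : straight w ->
  exists j, forall i, i < size w -> limit_point (j + i) = nth blank w i.
Proof.
move=> pw; pose t := choice.pickle w; exists (size (stage t) + gap t) => i iw.
have wE : nth_straight t = w by exact: nth_straight_pickle.
rewrite (@limit_pointE t.+1) ?size_stageS ?wE; last by lia.
rewrite stageS wE !nth_cat size_nseq ifF; last by lia.
by rewrite ifF; [rewrite ifT; [congr nth; lia | lia] | lia].
Qed.

Lemma limit_point_recurrent (N : nat) :
  exists2 d, N <= d & forall i, i < N -> limit_point (d + i) = limit_point i.
Proof.
pose t := N; exists (size (stage t) + gap t + size (nth_straight t) + gap t).
  by have := size_stage_ge t; lia.
move=> i iN; have it : i < size (stage t) by apply: leq_trans (size_stage_ge t).
rewrite (@limit_pointE t.+1) ?size_stageS; last by lia.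
rewrite stageS !nth_cat !size_nseq ifF; last by lia.
do 3!(rewrite ifF; last by lia).
by rewrite (@limit_pointE t i) //; congr nth; lia.
Qed.

(** The boolean form of membership in [Delta 2 4]. *)
Definition is_digit (d : nat * nat) : bool := (0 < d.1 <= 2) && (0 < d.2 <= 4).

Lemma hletters_is_digit (d : nat * nat) : d \in hletters -> is_digit d.
Proof. by rewrite !inE => /orP[] /eqP ->. Qed.

Lemma vletters_is_digit (d : nat * nat) : d \in vletters -> is_digit d.
Proof. by rewrite !inE => /or4P[] /eqP ->. Qed.

Lemma limit_point_digits (i : nat) : is_digit (limit_point i).
Proof.
suff st t : all is_digit (stage t).
  by have /all_nthP := st i.+1; apply; exact: size_stage_ge.
elim: t => // t IH; rewrite stageS !all_cat IH all_nseq orbT /= andbT.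
by have /orP[] := nth_straight_straight t; apply: sub_all => a;
  [exact: hletters_is_digit|exact: vletters_is_digit].
Qed.

Local Open Scope classical_set_scope.
Local Open Scope ring_scope.

(** * Orbit closures *)

(** Pointwise convergence of letters in a discrete alphabet is eventual equality,
    so the closure of an orbit consists of the sequences all of whose prefixes
    occur in the given point. *)
Definition orbit_closure {T : Type} (z : nat -> T) : set (nat -> T) :=
  [set x | forall N, exists j, forall i, (i < N)%N -> x i = z (j + i)%N].

Lemma orbit_closure_refl {T : Type} (z : nat -> T) : orbit_closure z z.
Proof. by move=> N; exists 0%N. Qed.

Lemma mkseq_orbit_closure {T : Type} (z x : nat -> T) (k N : nat) :
  orbit_closure z x ->
  exists j, mkseq (fun i => x (k + i)%N) N = mkseq (fun i => z (j + i)%N) N.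
Proof.
move=> /(_ (k + N)%N)[j xE]; exists (j + k)%N; apply/eq_in_map => i.
by rewrite mem_iota add0n => iN; rewrite xE ?ltn_add2l // addnA.
Qed.

Lemma language_orbit_closure {T : Type} (z : nat -> T) (w : seq T) :
  language (orbit_closure z) w <->
  exists j, w = mkseq (fun i => z (j + i)%N) (size w).
Proof.
split=> [[x [k [xz wE]]]|[j wE]]; last by exists z, j; split => //; exact: orbit_closure_refl.
by have [j] := mkseq_orbit_closure z x k (size w) xz; rewrite -wE; exists j.
Qed.

(** Both words occur in some prefix of [z]; recurrence brings that prefix back
    beyond the end of the first word, and [z] supplies the letters in between. *)
Lemma transitive_orbit_closure {T : Type} (z : nat -> T) :
  (forall N, exists2 d, (N <= d)%N & forall i, (i < N)%N -> z (d + i)%N = z i) ->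
  topologically_transitive (orbit_closure z).
Proof.
move=> zrec u v /language_orbit_closure[j uE] /language_orbit_closure[k vE].
have [d dge dE] := zrec (j + size u + k + size v)%N.
(* The second word sits at position d + k of z, the first one ends at j + size u. *)
set l := (d + k - j - size u)%N.
exists (mkseq (fun i => z (j + size u + i)%N) l).
  by apply/language_orbit_closure; exists (j + size u)%N; rewrite size_mkseq.
apply/language_orbit_closure; exists j.
rewrite !size_cat size_mkseq {1}uE {1}vE.
rewrite /mkseq !iotaD !map_cat add0n; congr (_ ++ (_ ++ _)).
  rewrite -[in RHS](addn0 (size u)) iotaDl -map_comp; apply/eq_map => i /=.
  by rewrite addnA.
rewrite -[in RHS](addn0 (size u + l)%N) iotaDl -map_comp.
apply/eq_in_map => i /=; rewrite mem_iota add0n => iv.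
rewrite -dE; last by lia.
by congr z; rewrite /l; lia.
Qed.

Lemma compact_orbit_closure {T : topologicalType} (A : set T) (z : nat -> T) :
  (forall a : T, nbhs a [set a]) -> finite_set A -> (forall i, A (z i)) ->
  compact (orbit_closure z : set {ptws nat -> T}).
Proof.
move=> disc finA Az.
apply: (@subclosed_compact _ _ [set f : {ptws nat -> T} | forall i, A (f i)]).
- move=> x xcl N.
  have : nbhs (x : {ptws nat -> T})
      [set y : {ptws nat -> T} | forall i, (i < N)%N -> y i = x i].
    elim: N => [|N IH]; first by apply: filterS filterT.
    apply: filterS (filterI IH (@proj_continuous _ (fun=> T) N x _ (disc (x N)))).
    move=> y [yN yx] i; rewrite ltnS leq_eqVlt => /predU1P[->|/yN //].
    exact: yx.
  move=> /xcl[y [/(_ N)[j yE] yx]]; exists j => i iN.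
  by rewrite -yx // yE.
- by apply: (@tychonoff _ (fun=> T) (fun=> A)) => i; exact: finite_compact.
- by move=> x xz i; have [j ->//] := xz i.+1.
Qed.

Lemma subshift_orbit_closure {T : topologicalType} (A : set T) (z : nat -> T) :
  (forall a : T, nbhs a [set a]) -> finite_set A -> (forall i, A (z i)) ->
  is_subshift A (orbit_closure z).
Proof.
move=> disc finA Az; split => //.
- by move=> x xz i; have [j ->//] := xz i.+1.
- exact: compact_orbit_closure disc finA Az.
- move=> _ [x xz <-] N; have [j xE] := xz N.+1; exists j.+1 => i iN.
  by rewrite /left_shift xE // addnS.
Qed.

(** The product topology of two discrete spaces is discrete. *)
Lemma nbhs_set1_natnat (a : nat * nat) : nbhs a [set a].
Proof.
exists ([set a.1], [set a.2]); first by split; exact: discrete_set1.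
by case: a => a b [c d] /= [-> ->].
Qed.

Definition sparse_shift : set (nat -> nat * nat) := orbit_closure limit_point.

Lemma finite_Delta (m n : nat) : finite_set (Delta m n).
Proof.
apply: (sub_finite_set (B := `I_m.+1 `*` `I_n.+1)); last exact: finite_setX.
by move=> [a b] /= /andP[/andP[_ am] /andP[_ bn]].
Qed.

Lemma sparse_subshift : is_subshift (Delta 2 4) sparse_shift.
Proof.
apply: subshift_orbit_closure; [exact: nbhs_set1_natnat|exact: finite_Delta|].
exact: limit_point_digits.
Qed.

Lemma sparse_transitive : topologically_transitive sparse_shift.
Proof. exact: transitive_orbit_closure limit_point_recurrent. Qed.

Lemma sparse_straight (x : nat -> nat * nat) :
  (forall k, straight (mkseq x k)) -> sparse_shift x.
Proof.
move=> xs N; have [j jE] := limit_point_straight _ (xs N).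
by exists j => i iN; rewrite jE ?size_mkseq // nth_mkseq.
Qed.

Lemma windows_of_sparse_shift (L : nat) :
  exists E : seq (seq (nat * nat)), (size E <= (5 * L).+1)%N /\
    forall x k, sparse_shift x -> mkseq (fun i => x (k + i)%N) L
      \in words_over hletters L ++ words_over vletters L ++ E.
Proof.
have [E [sE wE]] := windows_of_limit_point L; exists E; split => // x k xs.
by have [j ->] := mkseq_orbit_closure _ _ k L xs.
Qed.

(** * Entropies *)
Lemma card_fset_set_le (T : choiceType) (A : set T) (s : seq T) :
  A `<=` [set` s] -> (#|` fset_set A| <= size s)%N.
Proof.
move=> As; have finA : finite_set A := sub_finite_set As (finite_seq s).
apply: leq_trans (size_undup s); rewrite -card_fseq; apply: fsubset_leq_card.
by apply/fsubsetP => x; rewrite in_fset_set // inE => /As /=; rewrite in_fset.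
Qed.

Lemma card_fset_set_ge (T : choiceType) (A : set T) (s : seq T) :
  finite_set A -> uniq s -> [set` s] `<=` A -> (size s <= #|` fset_set A|)%N.
Proof.
move=> finA us sA; rewrite -(undup_id us) -card_fseq; apply: fsubset_leq_card.
by apply/fsubsetP => x; rewrite in_fset => /sA As; rewrite in_fset_set // inE.
Qed.

(** From [ln x = 2 * ln (sqrt x) <= 2 * sqrt x]: the quotient is at most
    [2 * sqrt (2 * C / k)]. *)
Lemma cvg_ln_linear (R : realType) (C : nat) : (0 < C)%N ->
  (fun k : nat => ln (C * k.+1)%:R / k%:R : R) @ \oo --> (0 : R).
Proof.
move=> C0.
have sq0 : (fun k : nat => 2 * Num.sqrt (2 * C%:R * k%:R^-1) : R) @ \oo --> (0 : R).
  rewrite -[X in _ --> X](mulr0 2); apply: cvgMr.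
  rewrite -[X in _ --> X](@sqrtr0 R).
  apply: continuous_cvg; first exact: sqrt_continuous.
  rewrite -[X in _ --> X](mulr0 (2 * C%:R)); apply: cvgMr.
  by apply/gtr0_cvgV0; [near=> k; rewrite ltr0n; near: k; exists 1%N|exact: cvgr_idn].
apply: (squeeze_cvgr _ (@cvg_cst _ _ _ _ _) sq0).
near=> k.
have k0 : (0 < k)%N by near: k; exists 1%N.
have kR : 0 < k%:R :> R by rewrite ltr0n.
have x1 : 1 <= (C * k.+1)%:R :> R by rewrite ler1n muln_gt0 C0.
set x := (C * k.+1)%:R in x1 *.
have x0 : 0 < x by apply: lt_le_trans x1.
apply/andP; split; first by rewrite divr_ge0 ?ln_ge0 // ltW.
have lnx : ln x <= 2 * Num.sqrt x.
  rewrite -{1}(sqr_sqrtr (ltW x0)) expr2 lnM ?posrE ?sqrtr_gt0 //.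
  by have := @ln_sublinear R (Num.sqrt x); rewrite sqrtr_gt0 => /(_ x0); lra.
rewrite ler_pdivrMr //; apply: le_trans lnx _.
have -> : 2 * Num.sqrt (2 * C%:R * k%:R^-1) * k%:R = 2 * Num.sqrt (2 * C%:R * k%:R) :> R.
  rewrite -mulrA -{2}(gtr0_norm kR) -sqrtr_sqr -sqrtrM; last first.
    by rewrite !mulr_ge0 ?invr_ge0 ?ler0n.
  by congr (_ * Num.sqrt _); field; rewrite pnatr_eq0 -lt0n.
rewrite ler_wpM2l // ler_wsqrtr // /x -!natrM ler_nat.
by rewrite [(2 * C)%N]mulnC -mulnA leq_mul2l; apply/orP; right; lia.
Unshelve. all: by end_near.
Qed.

Lemma ln_natX (R : realType) (a k : nat) : (0 < a)%N ->
  ln (a ^ k)%:R = k%:R * ln a%:R :> R.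
Proof. by move=> a0; rewrite natrX lnXn ?ltr0n // mulr_natl. Qed.

(** A factor linear in the length does not change the exponential growth rate. *)
Lemma entropy_of_growth (R : realType) (T : choiceType) (Sigma : set (nat -> T))
    (a C : nat) : (0 < a)%N ->
  (forall k, (a ^ k <= #|` fset_set (words Sigma k)| <= C * k.+1 * a ^ k)%N) ->
  entropy R Sigma = ln a%:R.
Proof.
move=> a0 H; apply/cvg_lim => //.
have C0 : (0 < C)%N.
  have := H 0%N; rewrite lt0n; case: (C) => [|//].
  by rewrite !mul0n => /andP[/leq_trans h /h].
have up : (fun k : nat => ln a%:R + ln (C * k.+1)%:R / k%:R : R) @ \oo --> (ln a%:R : R).
  rewrite -[X in _ --> X]addr0; apply: cvgD; first exact: cvg_cst.
  exact: cvg_ln_linear.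
apply: (squeeze_cvgr _ (@cvg_cst _ (ln a%:R : R) _ _ _) up).
near=> k.
have k0 : (0 < k)%N by near: k; exists 1%N.
have kR : 0 < k%:R :> R by rewrite ltr0n.
have /andP[lo hi] := H k.
have ak : (0 < a ^ k)%N by rewrite expn_gt0 a0.
rewrite mulrC ler_pdivlMr // ler_pdivrMr // mulrDl divfK ?gt_eqF //.
rewrite ![_ * k%:R]mulrC -ln_natX // -lnM ?posrE ?ltr0n ?muln_gt0 ?C0 // -natrM.
by rewrite !ler_ln ?posrE ?ltr0n ?ler_nat ?muln_gt0 ?C0 ?ak ?(leq_trans ak lo) // lo mulnC.
Unshelve. all: by end_near.
Qed.

Lemma straight_take (w v : seq (nat * nat)) : straight (w ++ v) -> straight w.
Proof. by rewrite /straight /= !all_cat => /orP[]/andP[-> _]; rewrite ?orbT. Qed.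

(** Straight sequences in the subshift are produced by completing finite words
    with blanks, which keeps them straight. *)
Definition padded (w : seq (nat * nat)) : nat -> nat * nat := nth blank w.

Lemma mkseq_padded (w : seq (nat * nat)) (k : nat) :
  mkseq (padded w) (size w + k) = w ++ nseq k blank.
Proof.
apply: (@eq_from_nth _ blank); first by rewrite size_mkseq size_cat size_nseq.
move=> i; rewrite size_mkseq => ik; rewrite nth_mkseq // nth_cat /padded.
by case: ltnP => wi //; rewrite nth_nseq if_same nth_default.
Qed.

Lemma straight_padded (w : seq (nat * nat)) (k : nat) :
  straight w -> straight (mkseq (padded w) k).
Proof.
move=> sw; have : straight (mkseq (padded w) (size w + k)).
  rewrite mkseq_padded /straight /=.
  case/orP: sw => sw; rewrite !all_cat sw !all_nseq.
    by have -> : blank \in hletters by []; rewrite orbT.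
  by have -> : blank \in vletters by []; rewrite !orbT.
rewrite addnC /mkseq iotaD map_cat; exact: straight_take.
Qed.

Lemma padded_sparse (w : seq (nat * nat)) : straight w -> sparse_shift (padded w).
Proof. by move=> sw; apply: sparse_straight => k; exact: straight_padded. Qed.

Lemma words_sparse_straight (w : seq (nat * nat)) :
  straight w -> words sparse_shift (size w) w.
Proof.
move=> sw; split=> //; exists (padded w), 0%N; split; first exact: padded_sparse.
by rewrite -[LHS]cats0 -(mkseq_padded w 0) addn0.
Qed.

Lemma card_words_sparse (k : nat) :
  (4 ^ k <= #|` fset_set (words sparse_shift k)| <= 7 * k.+1 * 4 ^ k)%N.
Proof.
have [E [sE wE]] := windows_of_sparse_shift k.
have sub : words sparse_shift k `<=`
    [set` words_over hletters k ++ words_over vletters k ++ E].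
  by move=> w [[x [j [xs wx]]] wk] /=; rewrite wx wk; exact: wE.
apply/andP; split.
  rewrite -[4%N]/(size vletters) -size_words_over; apply: card_fset_set_ge.
  - exact: sub_finite_set sub (finite_seq _).
  - exact: uniq_words_over.
  - move=> w /=; rewrite mem_words_over => /andP[/eqP <- wv].
    by apply: words_sparse_straight; rewrite /straight /= wv orbT.
apply: leq_trans (card_fset_set_le _ _ _ sub) _.
rewrite !size_cat !size_words_over /=.
have : (2 ^ k <= 4 ^ k)%N by case: (k) => // j; rewrite leq_exp2r.
nia.
Qed.

(** The projection is the full shift on two symbols, as every word over them is
    the projection of a horizontal word. *)
Lemma card_words_proj_sparse (k : nat) :
  (2 ^ k <= #|` fset_set (words (proj_seq @` sparse_shift) k)|
       <= 1 * k.+1 * 2 ^ k)%N.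
Proof.
have sub : words (proj_seq @` sparse_shift) k `<=` [set` words_over (iota 1 2) k].
  move=> w [[_ [j [[x xs <-] wx]]] wk] /=.
  rewrite mem_words_over wk eqxx wx andTb; apply/allP => a /mapP[i _ ->].
  have [l xl] := xs (j + i).+1; rewrite /proj_seq xl //.
  by have /andP[h _] := limit_point_digits (l + (j + i)); exact: etrans (mem_iota 1 2 _) h.
apply/andP; split.
  rewrite -[2%N]/(size (iota 1 2)) -size_words_over; apply: card_fset_set_ge.
  - exact: sub_finite_set sub (finite_seq _).
  - exact: uniq_words_over.
  - move=> w /=; rewrite mem_words_over => /andP[/eqP wk wi].
    pose v := [seq (a, 1%N) | a <- w].
    have vs : straight v.
      apply/orP; left; rewrite all_map; apply: sub_all wi => a ai.
      exact: (map_f (fun a => (a, 1%N))).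
    split => //; exists (proj_seq (padded v)), 0%N; split.
      by exists (padded v) => //; exact: padded_sparse.
    apply: (@eq_from_nth _ 1%N); rewrite ?size_mkseq // => i iw.
    by rewrite nth_mkseq // add0n /proj_seq /padded (nth_map 1%N).
apply: leq_trans (card_fset_set_le _ _ _ sub) _.
by rewrite size_words_over mul1n leq_pmull.
Qed.

Lemma entropy_sparse (R : realType) : entropy R sparse_shift = ln 4.
Proof. exact: (@entropy_of_growth _ _ _ 4 7 _ card_words_sparse). Qed.

Lemma entropy_proj_sparse (R : realType) :
  entropy R (proj_seq @` sparse_shift) = ln 2.
Proof. exact: (@entropy_of_growth _ _ _ 2 1 _ card_words_proj_sparse). Qed.

(** * The coding map *)

(** The lower left corner of the rectangle, of width [2 ^- size w] and height
    [4 ^- size w], that contains the images of all sequences starting with [w]. *)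
Definition corner {R : realType} (w : seq (nat * nat)) : R * R :=
  foldr (@affine_map R 2 4) (0, 0) w.

Lemma foldr_affine (R : realType) (w : seq (nat * nat)) (p : R * R) :
  foldr (@affine_map R 2 4) p w =
  ((corner w).1 + p.1 / 2 ^+ size w, (corner w).2 + p.2 / 4 ^+ size w).
Proof.
elim: w => [|d w IH] /=; first by rewrite !divr1 !add0r; case: p.
rewrite IH /affine_map /= !exprS; congr pair; field.
  by rewrite expf_neq0.
by rewrite expf_neq0.
Qed.

Lemma corner_cat (R : realType) (w v : seq (nat * nat)) :
  corner (w ++ v) = ((corner w).1 + (corner v).1 / 2 ^+ size w,
                     (corner w).2 + (corner v).2 / 4 ^+ size w) :> R * R.
Proof. by rewrite /corner foldr_cat foldr_affine. Qed.

Lemma corner_nseq_blank (R : realType) (k : nat) :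
  corner (nseq k blank) = (0, 0) :> R * R.
Proof.
elim: k => //= k IH; rewrite /corner /= -/(corner _) IH /affine_map /=.
by rewrite !add0r !subrr !mul0r.
Qed.

(** The rectangle of [w] lies in the unit square. *)
Lemma corner_itv (R : realType) (w : seq (nat * nat)) : all is_digit w ->
  (0 <= (@corner R w).1 <= 1 - 2 ^- size w) /\ (0 <= (@corner R w).2 <= 1 - 4 ^- size w).
Proof.
elim: w => [|[a b] w IH] /=; first by rewrite !invr1 !subrr !lexx.
move=> /andP[/andP[/andP[/= a0 a2] /andP[/= b0 b4]] /IH[]].
rewrite /corner /= -/(corner w); set x := (@corner R w).1; set y := (@corner R w).2.
rewrite !exprS !invfM.
set s := 2 ^- size w; set t := 4 ^- size w.
move=> /andP[x0 x1] /andP[y0 y1].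
have a0R : 1 <= a%:R :> R by rewrite ler1n.
have a2R : a%:R <= 2 :> R by rewrite ler_nat.
have b0R : 1 <= b%:R :> R by rewrite ler1n.
have b4R : b%:R <= 4 :> R by rewrite ler_nat.
by split; lra.
Qed.

Lemma mkseq_add {T : Type} (x : nat -> T) (k j : nat) :
  mkseq x (k + j) = mkseq x k ++ mkseq (fun i => x (k + i)%N) j.
Proof.
by rewrite /mkseq iotaD map_cat add0n -{2}(addn0 k) iotaDl -map_comp.
Qed.

Lemma all_mkseq {T : Type} (P : pred T) (x : nat -> T) (k : nat) :
  (forall i, P (x i)) -> all P (mkseq x k).
Proof. by move=> Px; rewrite all_map; apply/allP => i _ /=. Qed.

Lemma corner_mkseq_itv (R : realType) (x : nat -> nat * nat) (k l : nat) :
  (forall i, is_digit (x i)) -> (k <= l)%N ->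
  let p := @corner R (mkseq x k) in let q := @corner R (mkseq x l) in
  (p.1 <= q.1 <= p.1 + 2 ^- k) /\ (p.2 <= q.2 <= p.2 + 4 ^- k).
Proof.
move=> xd /subnKC <- /=; rewrite mkseq_add corner_cat /= size_mkseq.
set w := mkseq _ (l - k); have wd : all is_digit w by apply: all_mkseq => i; exact: xd.
have [/andP[x0 x1] /andP[y0 y1]] := corner_itv R w wd.
have h2 : 0 < 2 ^- k :> R by rewrite invr_gt0 exprn_gt0.
have h4 : 0 < 4 ^- k :> R by rewrite invr_gt0 exprn_gt0.
have g2 : 0 < 2 ^- size w :> R by rewrite invr_gt0 exprn_gt0.
have g4 : 0 < 4 ^- size w :> R by rewrite invr_gt0 exprn_gt0.
rewrite !lerD2l !lerDl !divr_ge0 ?exprn_ge0 //=.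
by rewrite !ler_piMl ?(ltW h2) ?(ltW h4) //; lra.
Qed.

(** Both coordinates of the corners are nondecreasing and bounded by 1, so the
    limit that [coding_map] selects exists. *)
Lemma cvg_coding_map (R : realType) (x : nat -> nat * nat) :
  (forall i, is_digit (x i)) ->
  (fun k => @corner R (mkseq x k)) @ \oo --> @coding_map R 2 4 x.
Proof.
move=> xd; rewrite /coding_map; set P := (X in get X).
suff : P (get P) by []; apply: getPex.
have mono (f : R * R -> R) :
    (forall k l, (k <= l)%N -> f (corner (mkseq x k)) <= f (corner (mkseq x l))) ->
    (forall k, f (corner (mkseq x k)) <= 1) ->
    exists a : R, (fun k => f (corner (mkseq x k))) @ \oo --> a.
  move=> fm f1; eexists; apply: nondecreasing_cvgn.
    by move=> k l; exact: fm.
  by exists 1 => _ [k _ <-].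
have [a xa] : exists a : R, (fun k => (@corner R (mkseq x k)).1) @ \oo --> a.
  apply: (mono fst) => [k l kl|k].
    by have [/andP[]] := corner_mkseq_itv R x k l xd kl.
  have [/andP[_ h] _] := corner_mkseq_itv R x 0 k xd isT.
  by apply: le_trans h _; rewrite /= add0r invr1.
have [b xb] : exists b : R, (fun k => (@corner R (mkseq x k)).2) @ \oo --> b.
  apply: (mono snd) => [k l kl|k].
    by have [_ /andP[]] := corner_mkseq_itv R x k l xd kl.
  have [_ /andP[_ h]] := corner_mkseq_itv R x 0 k xd isT.
  by apply: le_trans h _; rewrite /= add0r invr1.
exists (a, b); rewrite /P /=.
have -> : (fun k => foldr (@affine_map R 2 4) (0, 0) (mkseq x k)) =
          (fun k => ((@corner R (mkseq x k)).1, (@corner R (mkseq x k)).2)).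
  by apply/funext => k; rewrite -surjective_pairing.
exact: cvg_pair xa xb.
Qed.

Lemma coding_map_itv (R : realType) (x : nat -> nat * nat) (k : nat) :
  (forall i, is_digit (x i)) ->
  let p := @corner R (mkseq x k) in let q := @coding_map R 2 4 x in
  (p.1 <= q.1 <= p.1 + 2 ^- k) /\ (p.2 <= q.2 <= p.2 + 4 ^- k).
Proof.
move=> xd p q; have xq := cvg_coding_map R x xd.
have q1 : (fun k => (@corner R (mkseq x k)).1) @ \oo --> q.1 by exact: cvg_comp xq cvg_fst.
have q2 : (fun k => (@corner R (mkseq x k)).2) @ \oo --> q.2 by exact: cvg_comp xq cvg_snd.
have bd : \forall l \near \oo, (p.1 <= (@corner R (mkseq x l)).1 <= p.1 + 2 ^- k) /\
                             (p.2 <= (@corner R (mkseq x l)).2 <= p.2 + 4 ^- k).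
  by exists k => // l; exact: corner_mkseq_itv.
split; apply/andP; split.
- by apply: cvgr_to_ge q1 _; apply: filterS bd => l [/andP[]].
- by apply: cvgr_to_le q1 _; apply: filterS bd => l [/andP[]].
- by apply: cvgr_to_ge q2 _; apply: filterS bd => l [_ /andP[]].
- by apply: cvgr_to_le q2 _; apply: filterS bd => l [_ /andP[]].
Qed.

(** Blanks do not move the corner, so the corners of the prefixes are eventually
    constant. *)
Lemma coding_map_padded (R : realType) (w : seq (nat * nat)) : all is_digit w ->
  (@coding_map R 2 4 (padded w)).2 = (@corner R w).2.
Proof.
move=> wd; have pd i : is_digit (padded w i).
  rewrite /padded; have [iw|iw] := ltnP i (size w); last by rewrite nth_default.
  by have /all_nthP := wd; apply.
have lim1 : (fun k => (@corner R (mkseq (padded w) k)).2) @ \oo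
    --> (@coding_map R 2 4 (padded w)).2.
  exact: cvg_comp (cvg_coding_map R _ pd) cvg_snd.
have lim2 : (fun k => (@corner R (mkseq (padded w) k)).2) @ \oo --> (@corner R w).2.
  apply: cvg_near_cst; exists (size w) => // k /= /subnKC <-.
  by rewrite mkseq_padded corner_cat corner_nseq_blank /= mul0r addr0.
exact: (cvg_unique (@Rhausdorff R) lim1 lim2).
Qed.

(** * Covering numbers *)

(** The covering sets must have diameter exactly [delta].  Rectangles with sides
    [3 / 5 * delta] and [4 / 5 * delta] have that diagonal without any square
    root, and both sides exceed [delta / 2]. *)
Lemma coverable_boxes (R : realType) (E : set (R * R)) (delta : R)
    (s : seq (R * R)) : 0 < delta ->
  (forall p, E p -> exists2 c, c \in s &
     (c.1 <= p.1 <= c.1 + delta / 2) && (c.2 <= p.2 <= c.2 + delta / 2)) ->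
  coverable E delta (size s).
Proof.
move=> d0 Es; pose a := 3 / 5 * delta; pose b := 4 / 5 * delta.
have ab : a ^+ 2 + b ^+ 2 = delta ^+ 2 by rewrite /a /b; field.
pose c (i : 'I_(size s)) := nth (0, 0) s i.
exists (fun i => [set p | ((c i).1 <= p.1 <= (c i).1 + a) &&
                     ((c i).2 <= p.2 <= (c i).2 + b)]); split=> [i|p Ep].
- apply/eqP; rewrite eq_le; apply/andP; split.
    apply: ge_ereal_sup => _ [[p q] /= [/andP[p1 p2] /andP[q1 q2]] <-].
    rewrite lee_fin /euclid_dist -(gtr0_norm d0) -sqrtr_sqr ler_wsqrtr // -ab.
    have sq (u v x w : R) : x <= u <= x + w -> x <= v <= x + w -> (u - v) ^+ 2 <= w ^+ 2.
      move=> /andP[? ?] /andP[? ?]; rewrite -subr_ge0 subr_sqr mulr_ge0 //; lra.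
    by apply: lerD; [exact: sq p1 q1|exact: sq p2 q2].
  apply: ereal_sup_ubound.
  exists (((c i).1, (c i).2), ((c i).1 + a, (c i).2 + b)) => /=.
    have a0 : 0 <= a by rewrite /a; lra.
    have b0 : 0 <= b by rewrite /b; lra.
    by split; rewrite /= !lexx ?lerDl ?a0 ?b0.
  congr (_%:E); rewrite /euclid_dist /= -[RHS](gtr0_norm d0) -sqrtr_sqr -ab.
  by congr Num.sqrt; ring.
- have [x xs /andP[x1 x2]] := Es p Ep.
  have xi : (index x s < size s)%N by rewrite index_mem.
  exists (Ordinal xi) => //=; rewrite /c /= nth_index //.
  by apply/andP; split; rewrite /a /b; lra.
Qed.

(** A set of diameter [delta] contains at most one point of a family whose distinct
    points are more than [delta] apart. *)
Lemma coverable_separated (R : realType) (E : set (R * R)) (delta : R)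
    (s : seq (R * R)) (j : nat) :
  uniq s -> (forall p, p \in s -> E p) ->
  (forall p q, p \in s -> q \in s -> euclid_dist p q <= delta -> p = q) ->
  coverable E delta j -> (size s <= j)%N.
Proof.
move=> us sE sep [U [dU EU]].
have /choice[f fU] (p : R * R) : exists i : option 'I_j, p \in s ->
    exists2 k, i = Some k & U k p.
  have [ps|ps] := boolP (p \in s); last by exists None.
  by have [k _ Ukp] := EU p (sE p ps); exists (Some k) => _; exists k.
have finj : {in s &, injective f}.
  move=> p q ps qs fpq; have [k fk Up] := fU p ps; have [l fl Uq] := fU q qs.
  move: Uq; have -> : l = k by move: fl; rewrite -fpq fk => -[].
  move=> Uq; apply: sep => //; rewrite -lee_fin -(dU k).
  by apply: ereal_sup_ubound; exists (p, q).
have us' : uniq (map f s) by rewrite map_inj_in_uniq.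
have : {subset map f s <= map Some (enum 'I_j)}.
  move=> _ /mapP[p ps ->]; have [k -> _] := fU p ps.
  by rewrite mem_map ?mem_enum // => ? ? [].
by move/(uniq_leq_size us'); rewrite 2!size_map size_enum_ord.
Qed.

Lemma covering_number_itv (R : realType) (E : set (R * R)) (delta : R) (lo hi : nat) :
  coverable E delta hi -> (forall j, coverable E delta j -> (lo <= j)%N) ->
  (lo <= covering_number E delta <= hi)%N.
Proof.
move=> Ehi Elo; have ex : exists j, `[< coverable E delta j >] by exists hi; apply/asboolP.
pose P := [set k | coverable E delta k /\ forall j, coverable E delta j -> (k <= j)%N].
have [Ek mink] : P (covering_number E delta).
  apply: xgetPex; case: (ex_minnP ex) => k /asboolP Ek mink.
  by exists k; split => // j Ej; apply: mink; apply/asboolP.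
by rewrite Elo // mink.
Qed.

(** By induction on the length.  If the first letters differ, they contribute at
    least [1 / 4] to the distance, and the remaining words can take back at most
    [(1 - 4 ^- k) / 4]; if they agree, the distance is a quarter of the one for
    the remaining words. *)
Lemma corner_vletters_separated (R : realType) (k : nat) (w v : seq (nat * nat)) :
  w \in words_over vletters k -> v \in words_over vletters k ->
  `|(@corner R w).2 - (@corner R v).2| < 4 ^- k -> w = v.
Proof.
elim: k w v => [|k IH] w v; first by rewrite !inE => /eqP -> /eqP ->.
move=> /allpairsP[dw [dl w'k ->]] /allpairsP[ev [el v'k ->]].
case: dw ev dl w'k el v'k => d w' [e v'].
rewrite ![fst _]/= ![snd _]/= => dl w'k el v'k; rewrite /corner /= -!/(corner _) => lt.
have itv u : u \in words_over vletters k -> 0 <= (@corner R u).2 <= 1 - 4 ^- k.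
  rewrite mem_words_over => /andP[/eqP <- ul].
  have ud : all is_digit u by apply: sub_all ul => a; exact: vletters_is_digit.
  by have [] := corner_itv R u ud.
have /andP[w0 w1] := itv _ w'k; have /andP[v0 v1] := itv _ v'k.
move: lt; rewrite exprS invfM.
set x := (corner w').2 in w0 w1 *; set y := (corner v').2 in v0 v1 *.
set t := 4 ^- k in w1 v1 *.
move: dl el => /mapP[b _ ->] /mapP[c _ ->] /=.
rewrite ltr_norml => /andP[lt1 lt2].
have bc : b = c.
  apply/eqP; case: (ltngtP b c) => // bc.
    have : b%:R + 1 <= c%:R :> R by rewrite natr1 ler_nat.
    by lra.
  have : c%:R + 1 <= b%:R :> R by rewrite natr1 ler_nat.
  by lra.
subst c; congr cons; apply: IH => //.
by rewrite ltr_norml -/x -/y -/t; apply/andP; split; lra.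
Qed.

Lemma sparse_digits (x : nat -> nat * nat) :
  sparse_shift x -> forall i, is_digit (x i).
Proof. by move=> xs i; have [j ->] := xs i.+1; [exact: limit_point_digits|]. Qed.

Lemma corner_vletters (R : realType) (w : seq (nat * nat)) :
  all [in vletters] w -> (@corner R w).1 = 0.
Proof.
elim: w => //= d w IH /andP[/mapP[b _ ->] /IH].
by rewrite /corner /= -/(corner w) => ->; rewrite add0r subrr mul0r.
Qed.

(** Prefixes of length [2 k] determine the first coordinate up to [4 ^- k].  There
    would be [4 ^ (2 k)] vertical ones, but their first coordinate is 0, and their
    first [k] letters fix the second one with the required precision. *)
Lemma coverable_sparse (R : realType) (k : nat) (delta : R) : 4 ^- k <= delta / 2 ->
  exists2 j, (j <= 12 * k.+1 * 4 ^ k)%N &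
    coverable (@coding_map R 2 4 @` sparse_shift) delta j.
Proof.
move=> kd; have k0 : 0 < 4 ^- k :> R by rewrite invr_gt0 exprn_gt0.
have d0 : 0 < delta by lra.
have [E [sE wE]] := windows_of_sparse_shift (k + k).
pose s := words_over hletters (k + k) ++ words_over vletters k ++ E.
exists (size (map (@corner R) s)).
  rewrite size_map !size_cat !size_words_over /=.
  have -> : (2 ^ (k + k) = 4 ^ k)%N by rewrite expnD -expnMn.
  have : (0 < 4 ^ k)%N by rewrite expn_gt0.
  by nia.
apply: coverable_boxes => // _ [x xs <-]; have xd := sparse_digits x xs.
have [/andP[q1 q2] /andP[q3 q4]] := coding_map_itv R x (k + k) xd.
have [/andP[r1 r2] /andP[r3 r4]] := coding_map_itv R x k xd.
have e2 : 2 ^- (k + k) = 4 ^- k :> R.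
  by rewrite exprD -exprMn; congr (_ ^- _); rewrite -natrM.
have e4 : 4 ^- (k + k) <= 4 ^- k :> R.
  by rewrite lef_pV2 ?posrE ?exprn_gt0 // ler_eXn2l ?leq_addr // ltr1n.
have := wE x 0%N xs; rewrite -/(mkseq x (k + k)) !mem_cat => /or3P[xh|xv|xE].
- exists (corner (mkseq x (k + k))); first by rewrite map_f // !mem_cat xh.
  by apply/andP; split; lra.
- have v2 : all [in vletters] (mkseq x (k + k)).
    by move: xv; rewrite mem_words_over => /andP[].
  have v1 : all [in vletters] (mkseq x k) by move: v2; rewrite mkseq_add all_cat => /andP[].
  have kv : mkseq x k \in words_over vletters k by rewrite mem_words_over size_mkseq eqxx.
  exists (corner (mkseq x k)); first by rewrite map_f // !mem_cat kv orbT.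
  by move: q1 q2; rewrite !corner_vletters // => *; apply/andP; split; lra.
- exists (corner (mkseq x (k + k))); first by rewrite map_f // !mem_cat xE !orbT.
  by apply/andP; split; lra.
Qed.

Lemma coverable_sparse_ge (R : realType) (k : nat) (delta : R) (j : nat) :
  delta < 4 ^- k -> coverable (@coding_map R 2 4 @` sparse_shift) delta j ->
  (4 ^ k <= j)%N.
Proof.
move=> dk; rewrite -[4%N]/(size vletters) -size_words_over.
pose P w := @coding_map R 2 4 (padded w).
have vP w : w \in words_over vletters k -> (P w).2 = (@corner R w).2.
  rewrite mem_words_over => /andP[_ wv]; apply: coding_map_padded.
  by apply: sub_all wv => a; exact: vletters_is_digit.
rewrite -(size_map P); apply: coverable_separated.
- rewrite map_inj_in_uniq ?uniq_words_over // => w v wk vk Pwv.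
  apply: (corner_vletters_separated R k) => //.
  by rewrite -!vP // Pwv subrr normr0 invr_gt0 exprn_gt0.
- move=> _ /mapP[w wk ->]; exists (padded w) => //; apply: padded_sparse.
  by move: wk; rewrite mem_words_over /straight /= => /andP[_ ->]; rewrite orbT.
- move=> _ _ /mapP[w wk ->] /mapP[v vk ->] Pd; congr P.
  apply: (corner_vletters_separated R k) => //; rewrite -!vP //.
  apply: le_lt_trans dk; apply: le_trans Pd; rewrite /euclid_dist -sqrtr_sqr.
  by rewrite ler_wsqrtr // lerDr sqr_ge0.
Qed.

(** The squares of side [4 ^- k.+2 <= delta / 4] are small enough for
    [coverable_sparse]; passing from [k.+2] to [k] costs the factor 16 in the
    power and at most 3 in the linear factor, and [576 = 12 * 16 * 3]. *)
Lemma covering_number_sparse (R : realType) (k : nat) (delta : R) :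
  4 ^- k.+1 <= delta < 4 ^- k ->
  (4 ^ k <= covering_number (@coding_map R 2 4 @` sparse_shift) delta
         <= 576 * k.+1 * 4 ^ k)%N.
Proof.
move=> /andP[dlo dhi].
have [|j jle Ej] := coverable_sparse R k.+2 delta.
  rewrite exprS invfM; have : 0 < 4 ^- k.+1 :> R by rewrite invr_gt0 exprn_gt0.
  by lra.
have /andP[-> h] := covering_number_itv R _ delta _ j Ej
  (fun i => coverable_sparse_ge R k delta i dhi).
by apply: leq_trans h (leq_trans jle _); rewrite !expnS; nia.
Qed.

(** * Box dimension *)
Lemma limf_esup_cvg (R : realType) (T : choiceType) (X : filteredType T)
    (F : set_system X) (f : X -> R) (l : R) :
  ProperFilter F -> f @ F --> l -> limf_esup (fun x => (f x)%:E) F = l%:E.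
Proof.
move=> PF /cvgrPdist_le fl; rewrite limf_esupE; apply/eqP; rewrite eq_le; apply/andP; split.
  apply/lee_addgt0Pr => e e0; apply: le_trans (_ : ereal_sup _ <= _)%E.
    apply: ereal_inf_lbound; exists [set x | `|l - f x| <= e] => //; exact: fl.
  apply: ge_ereal_sup => _ [x /= + <-]; rewrite -EFinD lee_fin ler_norml; lra.
apply: le_ereal_inf_tmp => _ [V FV <-]; apply/lee_addgt0Pr => e e0.
have [x [Vx /= fx]] := filter_ex (filterI FV (fl e e0)).
rewrite -leeBlDr //; apply: le_ereal_sup_tmp; exists (f x)%:E; first by exists x.
by move: fx; rewrite -EFinB lee_fin ler_norml; lra.
Qed.

Lemma has_box_dim_of_cvg (R : realType) (E : set (R * R)) (s : R) :
  (fun delta => ln (covering_number E delta)%:R / - ln delta) @ 0^'+ --> s ->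
  has_box_dim E s.
Proof.
move=> cv; split; last exact: limf_esup_cvg cv.
rewrite /lower_box_dim /limf_einf.
have /limf_esup_cvg :
    (fun delta => - (ln (covering_number E delta)%:R / - ln delta)) @ 0^'+ --> - s.
  exact: cvgN.
by move=> ->; rewrite EFinN oppeK.
Qed.

Lemma geometric_scale (R : realType) (b : nat) (delta : R) : (1 < b)%N -> 0 < delta < 1 ->
  exists k, b%:R ^- k.+1 <= delta < b%:R ^- k.
Proof.
move=> b1 /andP[d0 d1].
have b0 : 0 < b%:R :> R by rewrite ltr0n; lia.
have ex : exists j, b%:R ^- j <= delta.
  exists (Num.truncn delta^-1).+1; rewrite invf_ple ?posrE ?exprn_gt0 //.
  have /ltW/le_trans -> // : delta^-1 < (Num.truncn delta^-1).+1%:R.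
    exact: truncnS_gt.
  by rewrite -natrX ler_nat ltnW // ltn_expl.
case: (ex_minnP ex) => -[|k] kd mink.
  by move: kd; rewrite expr0 invr1 leNgt d1.
by exists k; rewrite kd ltNge; apply/negP => /mink; rewrite ltnn.
Qed.

(** For [b ^- k.+1 <= delta < b ^- k], both the logarithm of the covering number
    and [- ln delta] are [k * ln b] up to an error of smaller order than [k]. *)
Lemma has_box_dim_of_growth (R : realType) (E : set (R * R)) (b C : nat) :
  (1 < b)%N -> (0 < C)%N ->
  (forall k delta, b%:R ^- k.+1 <= delta < b%:R ^- k ->
    (b ^ k <= covering_number E delta <= C * k.+1 * b ^ k)%N) ->
  has_box_dim E 1.
Proof.
move=> b1 C0 H; apply: has_box_dim_of_cvg; apply/cvgrPdist_le => e e0.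
have b0 : 0 < b%:R :> R by rewrite ltr0n; lia.
have L0 : 0 < ln b%:R :> R by rewrite ln_gt0 // ltr1n.
set L := ln b%:R in L0 *.
have /cvgrPdist_le/(_ (e * L) (mulr_gt0 e0 L0))[K1 _ HK1] := cvg_ln_linear R C C0.
have /cvgrPdist_le/(_ e e0)[K2 _ HK2] := @cvg_harmonic R.
pose K := (K1 + K2).+1.
near=> delta.
have d0 : 0 < delta by near: delta; exact: nbhs_right_gt.
have dK : delta < b%:R ^- K.
  by near: delta; apply: nbhs_right_lt; rewrite invr_gt0 exprn_gt0.
have d1 : delta < 1.
  by apply: lt_le_trans dK _; rewrite invf_le1 ?exprn_gt0 // exprn_ege1 // ler1n ltnW.
have [|k /andP[klo khi]] := geometric_scale R b delta b1; first by rewrite d0.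
have Kk : (K <= k)%N.
  rewrite leqNgt; apply/negP => kK.
  have h : b%:R ^- K <= b%:R ^- k.+1 :> R.
    by rewrite lef_pV2 ?posrE ?exprn_gt0 // ler_weXn2l // ler1n ltnW.
  by move: (lt_le_trans dK (le_trans h klo)); rewrite ltxx.
have K1k : (K1 < k)%N := leq_ltn_trans (leq_addr K2 K1) Kk.
have K2k : (K2 < k)%N := leq_ltn_trans (leq_addl K1 K2) Kk.
have kpos : (0 < k)%N := leq_ltn_trans (leq0n K1) K1k.
have k0 : 0 < k%:R :> R by rewrite ltr0n.
have /andP[Nlo Nhi] := H k delta (introT andP (conj klo khi)).
have Qe : ln (C * k.+1)%:R <= e * L * k%:R.
  have /HK1 /= : (K1 <= k)%N := ltnW K1k.
  by rewrite sub0r normrN => /(le_trans (ler_norm _)); rewrite ler_pdivrMr.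
have ke : 1 <= e * k%:R.
  have /HK2 /= : (K2 <= k.-1)%N by rewrite -ltnS prednK.
  rewrite prednK // sub0r normrN => /(le_trans (ler_norm _)).
  by rewrite -ler_pdivrMr // mul1r.
have bk0 : (0 < b ^ k)%N by rewrite expn_gt0 ltnW.
have C1 : (0 < C * k.+1)%N by rewrite muln_gt0 C0.
set N := covering_number E delta in Nlo Nhi *.
have N0 : (0 < N)%N by apply: leq_trans Nlo.
have lnlo : k%:R * L <= ln N%:R.
  by rewrite /L -ln_natX ?(ltnW b1) // ler_ln ?posrE ?ltr0n // ler_nat.
have lnhi : ln N%:R <= ln (C * k.+1)%:R + k%:R * L.
  rewrite /L -ln_natX ?(ltnW b1) // -lnM ?posrE ?ltr0n // -natrM.
  by rewrite ler_ln ?posrE ?ltr0n ?ler_nat // muln_gt0 C1.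
have lnbV k' : ln (b%:R ^- k') = - (k'%:R * L) :> R.
  by rewrite lnV ?posrE ?exprn_gt0 // lnXn // mulr_natl.
have dhi : - ln delta <= k.+1%:R * L.
  by rewrite lerNl -lnbV ler_ln ?posrE // invr_gt0 exprn_gt0.
have dlo : k%:R * L <= - ln delta.
  by rewrite lerNr -lnbV ler_ln ?posrE ?(ltW khi) // invr_gt0 exprn_gt0.
rewrite -natr1 in dhi.
set M := - ln delta in dlo dhi *.
have M0 : 0 < M by apply: lt_le_trans dlo; rewrite mulr_gt0.
have Me : e * (k%:R * L) <= e * M by rewrite ler_pM2l.
have Le : L <= e * k%:R * L by rewrite -[leLHS]mul1r ler_pM2r.
rewrite ler_distlC ler_pdivlMr // ler_pdivrMr // mulrBl mulrDl !mul1r.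
by apply/andP; split; lra.
Unshelve. all: by end_near.
Qed.

Theorem theorem1p3 (R : realType) :
  exists (m n : nat) (Sigma : set (nat -> nat * nat)),
    [/\ (2 <= m)%N /\ (m < n)%N,
        is_subshift (Delta m n) Sigma,
        topologically_transitive Sigma,
        0 < entropy R (proj_seq @` Sigma) < entropy R Sigma &
        has_box_dim (@coding_map R m n @` Sigma)
          (Num.max (entropy R Sigma / ln n%:R)
                   (entropy R (proj_seq @` Sigma) / ln m%:R))].
Proof.
have l2 : 0 < ln 2 :> R by rewrite ln_gt0 // ltr1n.
have l24 : ln 2 < ln 4 :> R by rewrite ltr_ln ?posrE // ltr_nat.
exists 2, 4, sparse_shift; rewrite entropy_sparse entropy_proj_sparse; split => //.
- exact: sparse_subshift.
- exact: sparse_transitive.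
- by rewrite l2.
- rewrite !divff ?gt_eqF ?maxxx //; last by apply: lt_trans l24.
  apply: (@has_box_dim_of_growth _ _ 4 576) => // k delta.
  exact: covering_number_sparse.
Qed.
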